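(* Let $\mathfrak R=(R_k,\zeta_k)_{k\in\mathcal K}$ be a complete reference family with a forest structure on $\{1,\dots,m\}$. Let $\mathcal L\subseteq\mathcal K$ be the final set returned by the pruning algorithm described in the context, and let $\mathcal K^{\mathfrak{pr}}$ be the pruned index set defined in the context. Then $\mathcal L=\mathcal K^{\mathfrak{pr}}$.
   Context: **Reference family with forest structure.** Let $m\ge1$ and let $(P_n)_{1\le n\le N}$ be a partition of $\{1,\dots,m\}$ into non-empty sets (called atoms or leaves). Let $\mathcal K\subseteq\{(a,b):1\le a\le b\le N\}$ be non-empty and for $k=(a,b)\in\mathcal K$ let $R_k=R_{(a,b)}=\bigcup_{a\le n\le b}P_n$. (So the $R_k$ are non-empty and pairwise distinct.) The forest structure assumption is: for all $k,k'\in\mathcal K$, $R_k\cap R_{k'}\in\{R_k,R_{k'},\varnothing\}$. For each $k\in\mathcal K$ let $\zeta_k\in\{0,\dots,|R_k|\}$ be an integer. The family is called complete if $(n,n)\in\mathcal K$ for all $1\le n\le N$. **Depth.** For $k\in\mathcal K$, $\phi(k)=1+|\{k'\in\mathcal K:R_k\subsetneq R_{k'}\}|$; $H=\max_{k\in\mathcal K}\phi(k)$; $\mathcal K^h=\{k\in\mathcal K:\phi(k)=h\}$ for $1\le h\le H$. **Pruned index set.** $\mathcal K^{\mathfrak{pr}}$ is the set of elements of $\mathcal K$ from which one removes all $(i,i')\in\mathcal K$ such that there exist $p\ge2$ and integers $i_1,\dots,i_{p-1}$ such that, setting $i_0=i$ and $i_p=i'+1$, the sequence $(i_0,\dots,i_p)$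 is strictly increasing, $(i_{j-1},i_j-1)\in\mathcal K$ for all $1\le j\le p$, and $\zeta_{(i,i')}=\zeta_{(i_0,i_p-1)}\ge\sum_{j=1}^p\zeta_{(i_{j-1},i_j-1)}$. **Pruning algorithm.** Initialize $\mathcal L=\mathcal K$ and $Vec_k=\zeta_k$ for $k\in\mathcal K^H$. For $h=H-1,H-2,\dots,1$ and for each $k\in\mathcal K^h$: let $Succ_k=\{k'\in\mathcal K^{h+1}:R_{k'}\subseteq R_k\}$. If $Succ_k=\varnothing$, set $Vec_k=\zeta_k$. Otherwise: if $\zeta_k\ge\sum_{k'\in Succ_k}Vec_{k'}$, remove $k$ from $\mathcal L$; and (in either case) set $Vec_k=\min\left(\zeta_k,\sum_{k'\in Succ_k}Vec_{k'}\right)$. At the end, return $\mathcal L$ (together with $\sum_{k\in\mathcal K^1}Vec_k$). *)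

(* Defs.v *)
From mathcomp Require Import all_boot finmap.
From mathcomp Require Import boolp.

Set Implicit Arguments.
Unset Strict Implicit.
Unset Printing Implicit Defensive.

(* The ground set {1, ..., m} is represented by 'I_m. Atoms and indices
   k = (a, b) keep their 1-based numbering as natural numbers: values of P
   outside 1..N and values of zeta outside K are irrelevant. *)

Definition atom_partition (m N : nat) (P : nat -> {set 'I_m}) : Prop :=
  [/\ forall n, 1 <= n <= N -> P n != set0,
      forall n n', 1 <= n <= N -> 1 <= n' <= N -> n <> n' ->
        [disjoint P n & P n']
    & \bigcup_(1 <= n < N.+1) P n = [set: 'I_m]].

(* The region R_k of k = (a, b) is the union of the atoms P_a, ..., P_b. *)
Definition region (m : nat) (P : nat -> {set 'I_m}) (k : nat * nat) :
    {set 'I_m} :=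
  \bigcup_(k.1 <= n < k.2.+1) P n.

Definition reference_family (m N : nat) (P : nat -> {set 'I_m})
    (K : {fset nat * nat}) (zeta : nat * nat -> nat) : Prop :=
  [/\ atom_partition N P,
      (K != fset0)%fset,
      forall k, k \in K -> [&& 1 <= k.1, k.1 <= k.2 & k.2 <= N]
    & forall k, k \in K -> zeta k <= #|region P k|].

Definition forest_structure (m : nat) (P : nat -> {set 'I_m})
    (K : {fset nat * nat}) : Prop :=
  forall k k', k \in K -> k' \in K ->
    [\/ region P k :&: region P k' = region P k,
        region P k :&: region P k' = region P k'
      | region P k :&: region P k' = set0].

Definition complete_family (N : nat) (K : {fset nat * nat}) : Prop :=
  forall n, 1 <= n <= N -> (n, n) \in K.

Definition depth (m : nat) (P : nat -> {set 'I_m}) (K : {fset nat * nat})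
    (k : nat * nat) : nat :=
  1 + #|` [fset k' in K | region P k \proper region P k']%fset|.

Definition max_depth (m : nat) (P : nat -> {set 'I_m})
    (K : {fset nat * nat}) : nat :=
  \max_(k <- K) depth P K k.

Definition level (m : nat) (P : nat -> {set 'I_m}) (K : {fset nat * nat})
    (h : nat) : {fset nat * nat} :=
  [fset k in K | depth P K k == h]%fset.

Definition removable (K : {fset nat * nat}) (zeta : nat * nat -> nat)
    (k : nat * nat) : Prop :=
  exists (p : nat) (i : nat -> nat),
    [/\ 2 <= p,
        i 0 = k.1 /\ i p = k.2.+1,
        forall j, j < p -> i j < i j.+1,
        forall j, 1 <= j <= p -> (i j.-1, (i j).-1) \in K
      & zeta k >= \sum_(1 <= j < p.+1) zeta (i j.-1, (i j).-1)].

Definition pruned_index_set (K : {fset nat * nat}) (zeta : nat * nat -> nat) :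
    {fset nat * nat} :=
  [fset k in K | ~~ `[< removable K zeta k >]]%fset.

Definition succ_set (m : nat) (P : nat -> {set 'I_m}) (K : {fset nat * nat})
    (h : nat) (k : nat * nat) : {fset nat * nat} :=
  [fset k' in level P K h.+1 | region P k' \subset region P k]%fset.

(* The algorithm's state is the pair (L, Vec). *)
Definition pruning_state : Type := ({fset nat * nat} * (nat * nat -> nat))%type.

Definition assign (Vec : nat * nat -> nat) (k : nat * nat) (v : nat) :
    nat * nat -> nat :=
  fun k' => if k' == k then v else Vec k'.

Definition prune_node (m : nat) (P : nat -> {set 'I_m}) (K : {fset nat * nat})
    (zeta : nat * nat -> nat) (h : nat) (st : pruning_state) (k : nat * nat) :
    pruning_state :=
  let: (L, Vec) := st in
  let Succ := succ_set P K h k in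
  if Succ == fset0%fset then (L, assign Vec k (zeta k))
  else
    let S := \sum_(k' <- Succ) Vec k' in
    (if zeta k >= S then (L `\ k)%fset else L,
     assign Vec k (minn (zeta k) S)).

(* The nodes of a level are visited in the enumeration order of finite sets;
   the order is immaterial, as a node only reads Vec on the level below. *)
Definition prune_level (m : nat) (P : nat -> {set 'I_m}) (K : {fset nat * nat})
    (zeta : nat * nat -> nat) (st : pruning_state) (h : nat) : pruning_state :=
  foldl (prune_node P K zeta h) st (level P K h).

(* The initial value 0 of Vec off the deepest level is a placeholder: it is
   always overwritten before being read. *)
Definition pruning_init (m : nat) (P : nat -> {set 'I_m}) (K : {fset nat * nat})
    (zeta : nat * nat -> nat) : pruning_state :=
  (K, fun k => if k \in level P K (max_depth P K) then zeta k else 0).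

(* [rev (iota 1 (H - 1))] is the list H-1, H-2, ..., 1. *)
Definition pruning_run (m : nat) (P : nat -> {set 'I_m}) (K : {fset nat * nat})
    (zeta : nat * nat -> nat) : pruning_state :=
  foldl (prune_level P K zeta) (pruning_init P K zeta)
        (rev (iota 1 (max_depth P K - 1))).

Definition pruning_algorithm (m : nat) (P : nat -> {set 'I_m})
    (K : {fset nat * nat}) (zeta : nat * nat -> nat) :
    {fset nat * nat} * nat :=
  let: (L, Vec) := pruning_run P K zeta in
  (L, \sum_(k <- level P K 1) Vec k).

(* Main.v *)
Require Import Defs.
From mathcomp Require Import all_boot finmap.
From mathcomp Require Import boolp zify.

Set Implicit Arguments.
Unset Strict Implicit.
Unset Printing Implicit Defensive.

(** The pruning algorithm is a dynamic program.  Since the atoms are non-empty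
    and disjoint, inclusion of regions is inclusion of index intervals, so the
    family is a laminar family of integer intervals; by completeness, the
    members of [K] inside a non-atomic interval [k] and one level below it
    partition [k] into proper subintervals ([succ_covers],
    [level_disjoint]).

    Call cost of a list of members of [K] the sum of their [zeta].  After a
    node [k] has been visited, [Vec k] is the least cost of a tiling of [k] by
    members of [K], the tiling [[:: k]] included ([optimal]).  This propagates
    from one level to the one above because a member of [K] properly included
    in [k] lies within a single element of [succ_set]: a tiling of [k] other
    than [[:: k]] therefore splits into tilings of the successors, which costs
    at least the sum of their [Vec] ([succ_sum_le]), and conversely optimal
    tilings of the successors can be concatenated ([succ_sum_attained]).  Hence
    the sum [S] that the algorithm compares with [zeta k] is the least cost of
    a tiling of [k] into at least two pieces, and [S <= zeta k] is exactly the
    condition under which [k] leaves the pruned index set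
    ([removable_succ]).  An atomic interval has no successor and no such
    tiling, so both sides keep it ([removable_atom]).  What remains is to
    carry these two facts as an invariant ([pruned_on]) through the two nested
    loops. *)

(** * Tilings of integer intervals *)

Definition has_atom (k : nat * nat) (n : nat) : bool := k.1 <= n <= k.2.

Definition inside (x k : nat * nat) : bool := (k.1 <= x.1) && (x.2 <= k.2).

Lemma inside_atom (x k : nat * nat) n :
  inside x k -> has_atom x n -> has_atom k n.
Proof. by rewrite /inside /has_atom; lia. Qed.

Lemma inside_anti (x k : nat * nat) : inside x k -> inside k x -> x = k.
Proof.
case: x k => [a b] [c d]; rewrite /inside /= => h h'.
by congr pair; lia.
Qed.

(** The intervals of [s] tile [[a, b)] from left to right: pairs carry closed
    intervals, whereas half-open bounds make concatenation immediate. *)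
Fixpoint chained (a : nat) (s : seq (nat * nat)) (b : nat) : bool :=
  if s is x :: s' then (x.1 == a) && chained x.2.+1 s' b else a == b.

Lemma chained_cat a s c t b :
  chained a s c -> chained c t b -> chained a (s ++ t) b.
Proof.
elim: s a => [|x s IHs] a /=; first by move=> /eqP->.
by case/andP=> -> /IHs.
Qed.

Lemma chained_flatten (Q : nat * nat -> Prop) (w u : nat * nat -> nat) s a b :
  chained a s b ->
  (forall x : nat * nat, x \in s -> exists t,
     [/\ chained x.1 t x.2.+1, forall y : nat * nat, y \in t -> Q y
       & \sum_(y <- t) w y = u x]) ->
  exists t, [/\ chained a t b, forall y : nat * nat, y \in t -> Q y
              & \sum_(y <- t) w y = \sum_(x <- s) u x].
Proof.
elim: s a => [|x s IHs] a /=.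
  by move=> ab _; exists [::]; split; rewrite ?big_nil.
case/andP=> /eqP <- ch refine.
have [y ys|t [cht Qt wt]] := IHs _ ch.
  by apply: refine; rewrite inE ys orbT.
have [r [chr Qr wr]] := refine x (mem_head _ _).
exists (r ++ t); split; first exact: chained_cat chr cht.
  by move=> y; rewrite mem_cat => /orP[/Qr|/Qt].
by rewrite big_cat big_cons /= wr wt.
Qed.

(** A family of disjoint intervals that covers [[a, b)] can be sorted: the
    interval that covers [a] begins there, and the others tile what it leaves. *)
Lemma chained_of_tiling (s : seq (nat * nat)) a b :
  a <= b -> uniq s ->
  (forall x : nat * nat, x \in s -> [&& a <= x.1, x.1 <= x.2 & x.2 < b]) ->
  (forall (x y : nat * nat) n, x \in s -> y \in s ->
     has_atom x n -> has_atom y n -> x = y) ->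
  (forall n, a <= n < b -> exists2 x : nat * nat, x \in s & has_atom x n) ->
  exists2 t, perm_eq t s & chained a t b.
Proof.
have [d] := ubnP (size s); elim: d s a => // d IHd s a.
move=> szs leab us bnd inj cov.
case: (ltngtP a b) leab => // [ltab _|eqab _]; last first.
  case: s {szs us inj cov} bnd => [|x s] bnd.
    by exists [::]; rewrite //= eqab.
  by exfalso; have := bnd x (mem_head _ _); lia.
have [x xs xa] : exists2 x : nat * nat, x \in s & has_atom x a.
  by apply: cov; lia.
have bx := bnd x xs.
have x1 : x.1 = a by move: xa; rewrite /has_atom; lia.
have [|||y|y z n|n hn|t pt cht] := IHd (rem x s) x.2.+1.
- by rewrite size_rem //; case: (s) xs szs => //= *; lia.
- by lia.
- exact: rem_uniq.
- rewrite mem_rem_uniq // inE => /andP[/eqP yx ys].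
  have by_ := bnd y ys.
  have : ~ has_atom x y.1.
    by move=> h; apply: yx; apply: (inj y x y.1) => //; rewrite /has_atom; lia.
  by rewrite /has_atom; lia.
- by move=> /mem_rem ys /mem_rem zs; apply: inj.
- have [|y ys yn] := cov n; first by lia.
  exists y => //; rewrite mem_rem_uniq // inE ys andbT.
  by apply/eqP=> yx; move: yn; rewrite yx /has_atom; lia.
exists (x :: t); last by rewrite /= x1 eqxx.
by rewrite perm_sym (perm_trans (perm_to_rem xs)) // perm_cons perm_sym.
Qed.

(** With default value [b], the left ends of a tiling of [[a, b)] form its whole
    sequence of cut points, the final one included. *)
Lemma nth_chained s a b j : chained a s b -> j < size s ->
  nth b (unzip1 s) j.+1 = (nth (0, 0) s j).2.+1.
Proof.
elim: s a j => // x s IHs a [|j] /= /andP[_ ch] hj; last exact: IHs ch hj.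
by case: s ch {IHs hj} => [|y s] /= => [/eqP|/andP[/eqP]].
Qed.

Lemma removable_of_chained (K : {fset nat * nat}) zeta (k : nat * nat) s :
  (forall x : nat * nat, x \in K -> x.1 <= x.2) ->
  chained k.1 s k.2.+1 -> (forall x : nat * nat, x \in s -> x \in K) ->
  1 < size s -> \sum_(x <- s) zeta x <= zeta k -> removable K zeta k.
Proof.
move=> Kwf ch sK sz le_zeta.
pose i := nth k.2.+1 (unzip1 s).
have iS j : j < size s -> i j.+1 = (nth (0, 0) s j).2.+1.
  exact: nth_chained ch.
have i1 j : j < size s -> i j = (nth (0, 0) s j).1.
  by move=> js; rewrite /i (nth_map (0, 0)).
have iE j : j < size s -> (i j, (i j.+1).-1) = nth (0, 0) s j.
  by move=> js; rewrite iS // i1 //=; case: nth.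
exists (size s), i; split=> //.
- split; last by rewrite /i nth_default // size_map.
  by rewrite /i; case: (s) ch sz => // x s' /= /andP[/eqP].
- move=> j js; rewrite iS // i1 // ltnS.
  by apply/Kwf/sK; rewrite mem_nth.
- by case=> // j /= js; rewrite iE //; apply/sK/mem_nth.
rewrite big_add1 /= (leq_trans _ le_zeta) // (big_nth (0, 0)).
rewrite !big_nat leq_sum // => j /andP[_ js].
by rewrite iE.
Qed.

(** The pieces may overlap or repeat: minimal cost is bounded below over
    coverings, which unlike tilings restrict to a subinterval by mere
    filtering. *)
Definition covering (K : {fset nat * nat}) (k : nat * nat)
    (s : seq (nat * nat)) : Prop :=
  (forall x : nat * nat, x \in s -> (x \in K) && inside x k) /\
  (forall n, has_atom k n -> exists2 x : nat * nat, x \in s & has_atom x n).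

Lemma covering_of_removable (K : {fset nat * nat}) zeta k :
  removable K zeta k ->
  exists s, [/\ covering K k s, k \notin s & \sum_(x <- s) zeta x <= zeta k].
Proof.
case=> p [i [p2 [i0 ip] iS iK le_zeta]].
have imono j l : j <= l <= p -> i j + (l - j) <= i l.
  elim: l => [|l IHl] jl; first by rewrite (_ : j = 0) ?addn0 //; lia.
  have [->|jl'] := eqVneq j l.+1; first lia.
  by have := iS l; have := IHl; lia.
exists [seq (i j, (i j.+1).-1) | j <- iota 0 p]; split; first split.
- move=> x /mapP[j]; rewrite mem_iota => /andP[_ jp] ->.
  rewrite (iK j.+1) //= /inside /=.
  by have := imono 0 j; have := imono j.+1 p; lia.
- move=> n; rewrite /has_atom => kn.
  (* the piece of [n] ends at the first cut point beyond [n] *)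
  have /ex_minnP[l] : exists l, (n < i l) && (l <= p) by exists p; lia.
  case: l => [|j] /andP[nj jp] jmin; first by lia.
  exists (i j, (i j.+1).-1); last first.
    by have := jmin j; rewrite /has_atom /=; lia.
  by apply/mapP; exists j; rewrite ?mem_iota.
- (* a piece equal to [k] would leave room for one strict step only *)
  apply/negP=> /mapP[j]; rewrite mem_iota => /andP[_ jp] kE.
  move: i0 ip; rewrite kE /= => i0 ip.
  by have := imono 0 j; have := imono j.+1 p; have := iS j; lia.
apply: leq_trans le_zeta.
by rewrite big_map big_add1 /= /index_iota subn0.
Qed.

(** [v] is the least cost of a tiling of [k] by members of [K]; the minimum is
    the same over tilings and over coverings, so existence asks for the former
    and the bound is against the latter. *)
Definition optimal (K : {fset nat * nat}) zeta (k : nat * nat) (v : nat) :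
    Prop :=
  (exists s, [/\ chained k.1 s k.2.+1,
                  forall x : nat * nat, x \in s -> (x \in K) && inside x k
               & \sum_(x <- s) zeta x = v]) /\
  (forall s, covering K k s -> v <= \sum_(x <- s) zeta x).

(** * Regions as intervals *)

Section Forest.

Variables (m N : nat) (P : nat -> {set 'I_m}).
Variables (K : {fset nat * nat}) (zeta : nat * nat -> nat).
Hypothesis family : reference_family N P K zeta.
Hypothesis forest : forest_structure P K.
Hypothesis complete : complete_family N K.

Let bounds (k : nat * nat) : k \in K -> [&& 1 <= k.1, k.1 <= k.2 & k.2 <= N].
Proof. by case: family => _ _ + _; apply. Qed.

Lemma has_first_atom (k : nat * nat) : k \in K -> has_atom k k.1.
Proof. by move=> /bounds/and3P[_ k12 _]; rewrite /has_atom leqnn. Qed.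

Lemma mem_region (k : nat * nat) z :
  (z \in region P k) = has (fun n => z \in P n) (index_iota k.1 k.2.+1).
Proof.
rewrite /region; elim: index_iota => [|l r IHr]; first by rewrite big_nil inE.
by rewrite big_cons inE IHr.
Qed.

Lemma mem_region_atom n (k : nat * nat) z : 1 <= n <= N -> k \in K ->
  z \in P n -> (z \in region P k) = has_atom k n.
Proof.
move=> nN kK zn; have kb := bounds kK; rewrite mem_region.
apply/hasP/idP => [[l]|kn]; rewrite ?mem_index_iota.
  move=> lk zl; suff -> : n = l by [].
  case: family => -[_ disj _] _ _ _; apply/eqP/negP=> /negP/eqP nl.
  have lN : 1 <= l <= N by lia.
  by have /pred0P/(_ z) := disj _ _ nN lN nl; rewrite /= zn zl.
by exists n => //; rewrite mem_index_iota.
Qed.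

Lemma atom_witness (k : nat * nat) n : k \in K -> has_atom k n ->
  1 <= n <= N /\ exists z, z \in P n.
Proof.
move=> /bounds kb kn; have nN : 1 <= n <= N by move: kn; rewrite /has_atom; lia.
by split=> //; case: family => -[ne _ _] _ _ _; apply/set0Pn/ne.
Qed.

Lemma sub_region (x k : nat * nat) : x \in K -> k \in K ->
  (region P x \subset region P k) = inside x k.
Proof.
move=> xK kK; have xb := bounds xK; have kb := bounds kK.
apply/subsetP/idP => [sub|/andP[ins1 ins2] z].
  have mem n : has_atom x n -> has_atom k n.
    move=> xn; have [nN [z zn]] := atom_witness xK xn.
    by have := sub z; rewrite !(mem_region_atom nN) //; apply.
  have := mem x.1; have := mem x.2; rewrite /has_atom /inside; lia.
rewrite !mem_region => /hasP[n]; rewrite mem_index_iota => nx zn.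
by apply/hasP; exists n; rewrite // mem_index_iota; lia.
Qed.

Lemma proper_region (x k : nat * nat) : x \in K -> k \in K ->
  (region P x \proper region P k) = inside x k && (x != k).
Proof.
move=> xK kK; rewrite properE !sub_region //.
case: (boolP (inside x k)) => //= xk; congr negb.
apply/idP/eqP => [|->]; first exact: inside_anti.
by rewrite /inside !leqnn.
Qed.

Lemma laminar (x y : nat * nat) n : x \in K -> y \in K ->
  has_atom x n -> has_atom y n -> inside x y || inside y x.
Proof.
move=> xK yK xn yn; have [nN [z zn]] := atom_witness xK xn.
rewrite -!sub_region //; have [<-|<-|/setP/(_ z)] := forest xK yK.
- by rewrite subsetIr.
- by rewrite subsetIl orbT.
by rewrite !inE !(mem_region_atom nN) // xn yn.
Qed.

(** * Depth and successors *)

Local Open Scope fset_scope.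
Local Notation dep := (depth P K).

Lemma depth_proper (x k : nat * nat) : x \in K -> k \in K ->
  inside x k -> x != k -> dep k < dep x.
Proof.
move=> xK kK xk nxk; have pxk : region P x \proper region P k.
  by rewrite proper_region // xk.
rewrite /depth !add1n ltnS; apply: fproper_ltn_card; rewrite fproperE.
apply/andP; split; [apply/fsubsetP=> y|apply/fsubsetPn; exists k].
- by rewrite !inE /= => /andP[-> ky]; apply: proper_trans ky.
- by rewrite !inE /= kK pxk.
- by rewrite !inE /= properxx andbF.
Qed.

Lemma depth_le_max (k : nat * nat) : k \in K -> dep k <= max_depth P K.
Proof. by move=> kK; rewrite /max_depth (big_fsetD1 k) //= leq_maxl. Qed.

Lemma mem_succ (k c : nat * nat) : k \in K ->
  (c \in succ_set P K (dep k) k) =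
  [&& c \in K, inside c k & dep c == (dep k).+1].
Proof.
move=> kK; rewrite !inE /=; case: (boolP (c \in K)) => //= cK.
by rewrite sub_region // andbC.
Qed.

(** Among the members of [K] that contain [n] and lie strictly within [k], one
    exists by completeness; one of least depth is one level below [k], for by
    laminarity its proper supersets are [k] and the proper supersets of [k]. *)
Lemma succ_covers (k : nat * nat) n : k \in K -> k.1 < k.2 -> has_atom k n ->
  exists2 c : nat * nat, c \in succ_set P K (dep k) k & has_atom c n.
Proof.
move=> kK k12 kn.
have nK : (n, n) \in K by apply: complete; case: (atom_witness kK kn).
pose cand c := [&& c \in K, inside c k, c != k & has_atom c n].
have : exists d, has (fun c => cand c && (dep c == d)) K.
  exists (dep (n, n)); apply/hasP; exists (n, n); rewrite // eqxx /cand nK.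
  move: kn; rewrite /has_atom /inside /= => ->; rewrite !leqnn !andbT.
  by apply/eqP=> kE; move: k12; rewrite -kE ltnn.
case/ex_minnP=> d /hasP[c _ /andP[/and4P[cK ck nck cn] /eqP <-]] dmin.
exists c => //; rewrite mem_succ // cK ck /= /depth !add1n eqSS.
have pck : region P c \proper region P k by rewrite proper_region // ck.
suff -> : [fset x in K | region P c \proper region P x] =
          k |` [fset x in K | region P k \proper region P x].
  by rewrite cardfsU1 !inE /= properxx andbF.
apply/fsetP=> x; rewrite !inE /=; have [->|nxk] /= := eqVneq x k.
  by rewrite kK.
case: (boolP (x \in K)) => //= xK.
apply/idP/idP => [pcx|]; last exact: proper_trans.
have := pcx; rewrite !proper_region // => /andP[cx ncx].
have xn := inside_atom cx cn.
have /orP[kx|xk] := laminar kK xK kn xn; first by rewrite kx eq_sym.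
have : dep c <= dep x.
  by apply: dmin; apply/hasP; exists x; rewrite // /cand xK xk nxk xn eqxx.
by rewrite leqNgt depth_proper.
Qed.

Lemma level_disjoint (x y : nat * nat) n : x \in K -> y \in K ->
  dep x = dep y -> has_atom x n -> has_atom y n -> x = y.
Proof.
move=> xK yK eqd xn yn; apply/eqP/negPn/negP=> nxy.
have /orP[ins|ins] := laminar xK yK xn yn.
  by have := depth_proper xK yK ins nxy; rewrite eqd ltnn.
by have := depth_proper yK xK ins; rewrite eq_sym eqd ltnn => /(_ nxy).
Qed.

(** Otherwise [x] would lie strictly between [c] and [k], whose depths are
    consecutive. *)
Lemma inside_succ (k c x : nat * nat) n : k \in K ->
  c \in succ_set P K (dep k) k -> x \in K -> inside x k -> x != k ->
  has_atom x n -> has_atom c n -> inside x c.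
Proof.
move=> kK; rewrite mem_succ // => /and3P[cK ck /eqP dc] xK xk nxk xn cn.
have /orP[//|cx] := laminar xK cK xn cn.
have [->|nxc] := eqVneq x c; first by rewrite /inside !leqnn.
have := depth_proper xK kK xk nxk; have := depth_proper cK xK cx.
by rewrite eq_sym dc => /(_ nxc); lia.
Qed.

Lemma succ_prop (k c : nat * nat) : k \in K -> c \in succ_set P K (dep k) k ->
  [/\ c \in K, inside c k & dep c = (dep k).+1].
Proof. by move=> kK; rewrite mem_succ // => /and3P[? ? /eqP]. Qed.

Lemma succ_neq (k c : nat * nat) : k \in K ->
  c \in succ_set P K (dep k) k -> c != k.
Proof.
move=> kK; rewrite mem_succ // => /and3P[_ _ /eqP dc].
by apply/eqP=> ck; move: dc; rewrite ck; lia.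
Qed.

(** Completeness gives a successor to every interval with at least two atoms. *)
Lemma succ_eq0 (k : nat * nat) : k \in K ->
  (succ_set P K (dep k) k == fset0) = (k.1 == k.2).
Proof.
move=> kK; have kb := bounds kK; apply/eqP/eqP => [s0|k12].
  apply/eqP/negP=> /negP nk.
  have [||c] := @succ_covers k k.1 kK; rewrite ?s0 //; first lia.
  by rewrite /has_atom; lia.
apply/fsetP=> c; rewrite in_fset0; apply/negP=> cs; have := succ_neq kK cs.
move: cs; rewrite mem_succ // => /and3P[cK ck _] /eqP; apply.
apply: inside_anti => //; have := bounds cK; move: ck; rewrite /inside; lia.
Qed.

(** * The recursion on least costs *)

(** The pieces of [s] that lie within a successor [c] cover [c], hence cost at
    least [v c]; the successors being disjoint, no piece is counted twice. *)
Lemma succ_sum_le (k : nat * nat) (v : nat * nat -> nat) s : k \in K ->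
  (forall c : nat * nat, c \in succ_set P K (dep k) k ->
     optimal K zeta c (v c)) ->
  covering K k s -> k \notin s ->
  \sum_(c <- succ_set P K (dep k) k) v c <= \sum_(x <- s) zeta x.
Proof.
move=> kK opt [sK cov] ks; set S := succ_set P K (dep k) k.
apply: (@leq_trans (\sum_(c <- S) \sum_(x <- s | inside x c) zeta x)).
  rewrite big_seq [in leqRHS]big_seq leq_sum // => c cS.
  rewrite -big_filter; apply: (opt c cS).2; split=> [x|n cn].
    by rewrite mem_filter => /andP[-> /sK/andP[->]].
  have [cK ck _] := succ_prop kK cS.
  have [|x xs xn] := cov n; first exact: inside_atom ck cn.
  have [xK xk] := andP (sK x xs); exists x => //; rewrite mem_filter xs andbT.
  apply: (inside_succ kK cS) xn cn => //.
  by apply: contraNneq ks => <-.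
rewrite (eq_bigr _ (fun c _ => big_mkcond _ _)) exchange_big /=.
rewrite big_seq [leqRHS]big_seq leq_sum // => x xs.
have /andP[xK _] := sK x xs.
case: (boolP (has (inside x) S)) => [/hasP[c cS xc]|/hasPn noc].
  rewrite (big_fsetD1 c) //= xc big_seq big1 ?addn0 // => c'.
  rewrite in_fsetD1 => /andP[nc'c c'S]; case: ifP => // xc'.
  have [cK _ dc] := succ_prop kK cS.
  have [c'K _ dc'] := succ_prop kK c'S.
  case/eqP: nc'c; apply: (@level_disjoint _ _ x.1) => //; first by rewrite dc.
    exact: inside_atom xc' (has_first_atom xK).
  exact: inside_atom xc (has_first_atom xK).
by rewrite big_seq big1 // => c /noc/negbTE->.
Qed.

(** The successors, sorted, tile [k]; an optimal tiling of each refines this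
    to a tiling of [k] that uses only proper subintervals. *)
Lemma succ_sum_attained (k : nat * nat) (v : nat * nat -> nat) :
  k \in K -> k.1 < k.2 ->
  (forall c : nat * nat, c \in succ_set P K (dep k) k ->
     optimal K zeta c (v c)) ->
  exists s, [/\ chained k.1 s k.2.+1,
    forall x : nat * nat, x \in s -> [/\ x \in K, inside x k & x != k]
    & \sum_(x <- s) zeta x = \sum_(c <- succ_set P K (dep k) k) v c].
Proof.
move=> kK k12 opt; set S := succ_set P K (dep k) k.
have SK (c : nat * nat) : c \in S ->
    [/\ c \in K, inside c k & dep c = (dep k).+1] := succ_prop kK.
have [|||x y n|n|t pt cht] := @chained_of_tiling S k.1 k.2.+1.
- by lia.
- exact: fset_uniq.
- move=> x /SK[/bounds xb xk _]; move: xk; rewrite /inside; lia.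
- move=> /SK[xK _ dx] /SK[yK _ dy]; apply: level_disjoint => //.
  by rewrite dx.
- by rewrite ltnS => kn; apply: succ_covers.
rewrite -(perm_big _ pt).
apply: (chained_flatten cht) => c; rewrite (perm_mem pt) => cS.
have [[s [chs sK <-]] _] := opt c cS; exists s; split=> // x /sK/andP[xK xc].
have [cK ck _] := SK c cS; split=> //.
  by move: xc ck; rewrite /inside; lia.
have := succ_neq kK cS; apply: contraNneq => xk; rewrite xk in xc.
exact/eqP/inside_anti.
Qed.

Lemma removable_succ (k : nat * nat) (v : nat * nat -> nat) :
  k \in K -> k.1 < k.2 ->
  (forall c : nat * nat, c \in succ_set P K (dep k) k ->
     optimal K zeta c (v c)) ->
  removable K zeta k <-> \sum_(c <- succ_set P K (dep k) k) v c <= zeta k.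
Proof.
move=> kK k12 opt; split=> [/covering_of_removable[s [cov ks le_zeta]]|le_zeta].
  exact: leq_trans (succ_sum_le kK opt cov ks) le_zeta.
have [s [chs sK ws]] := succ_sum_attained kK k12 opt.
apply: (@removable_of_chained _ _ _ s) => //; last by rewrite ws.
- by move=> x /bounds/and3P[].
- by move=> x /sK[].
(* a tiling of [k] with a single piece is [[:: k]] *)
case: s chs sK {ws} => [|x [|y s]] //=; first by lia.
move=> /andP[/eqP x1 /eqP x2] /(_ x (mem_head _ _))[_ _ /eqP[]].
by case: x k x1 x2 {kK k12 opt le_zeta} => [a b] [c d] /= -> [->].
Qed.

Lemma removable_atom (k : nat * nat) : k.1 = k.2 -> ~ removable K zeta k.
Proof.
move=> k12 [p [i [p2 [i0 ip] iS _ _]]].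
have i_ge j : j <= p -> i 0 + j <= i j.
  elim: j => [|j IHj] jp; first lia.
  by have := IHj; have := iS j jp; lia.
by have := i_ge p; lia.
Qed.

Lemma optimal_succ (k : nat * nat) (v : nat * nat -> nat) :
  k \in K -> k.1 < k.2 ->
  (forall c : nat * nat, c \in succ_set P K (dep k) k ->
     optimal K zeta c (v c)) ->
  optimal K zeta k (minn (zeta k) (\sum_(c <- succ_set P K (dep k) k) v c)).
Proof.
move=> kK k12 opt; split=> [|s cov].
  have [le_zeta|lt_zeta] := leqP (zeta k) _.
    exists [:: k]; rewrite /= !eqxx big_seq1; split=> // x.
    by rewrite inE => /eqP->; rewrite kK /inside !leqnn.
  have [s [chs sK ws]] := succ_sum_attained kK k12 opt.
  by exists s; split=> // x /sK[-> ->].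
rewrite geq_min; case: (boolP (k \in s)) => ks.
  by rewrite (big_rem k) //= leq_addr.
by rewrite (succ_sum_le kK opt cov ks) orbT.
Qed.

Lemma optimal_atom (k : nat * nat) : k \in K -> k.1 = k.2 ->
  optimal K zeta k (zeta k).
Proof.
move=> kK k12; split=> [|s [sK cov]].
  exists [:: k]; rewrite /= !eqxx big_seq1; split=> // x.
  by rewrite inE => /eqP->; rewrite kK /inside !leqnn.
have [|x xs _] := cov k.1; first by rewrite /has_atom k12 !leqnn.
have [xK xk] := andP (sK x xs).
have <- : x = k.
  apply: inside_anti => //.
  by have := bounds xK; move: xk; rewrite /inside; lia.
by rewrite (big_rem x) //= leq_addr.
Qed.

(** * Correctness of the algorithm *)

(** The invariant of the loops, [D] being the set of nodes settled so far. *)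
Definition pruned_on (D : pred (nat * nat)) (st : pruning_state) : Prop :=
  (forall k : nat * nat, k \in K -> D k -> optimal K zeta k (st.2 k)) /\
  (forall k : nat * nat,
     (k \in st.1) = (k \in K) && ~~ (D k && `[< removable K zeta k >])).

Lemma pruned_on_node (D : pred (nat * nat)) st (k : nat * nat) : k \in K ->
  (forall c : nat * nat, c \in K -> dep c = (dep k).+1 -> D c) ->
  pruned_on D st -> pruned_on (predU1 k D) (prune_node P K zeta (dep k) st k).
Proof.
case: st => L v kK Dlow [/= vopt Lmem].
have opt c : c \in succ_set P K (dep k) k -> optimal K zeta c (v c).
  by rewrite mem_succ // => /and3P[cK _ /eqP dc]; apply/vopt/Dlow.
have kb := bounds kK; rewrite /prune_node succ_eq0 //.
have [k12|k12] := eqVneq k.1 k.2; split=> /= x.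
- move=> xK; rewrite /assign; have [-> _|_ /=] := eqVneq x k.
    exact: optimal_atom.
  exact: vopt.
- rewrite Lmem; have [->|_] //= := eqVneq x k.
  by rewrite (asboolF (removable_atom k12)) !andbF.
- move=> xK; rewrite /assign; have [-> _|_ /=] := eqVneq x k.
    by apply: optimal_succ => //; lia.
  exact: vopt.
have k12' : k.1 < k.2 by lia.
have rem := removable_succ kK k12' opt.
case: ifPn => le_zeta; rewrite ?in_fsetD1 Lmem; have [->|_] //= := eqVneq x k.
  by rewrite (asboolT (rem.2 le_zeta)) andbF.
by rewrite (asboolF (fun r => negP le_zeta (rem.1 r))) !andbF.
Qed.

Lemma eq_pruned_on (D D' : pred (nat * nat)) st :
  {in K, D =1 D'} -> pruned_on D st -> pruned_on D' st.
Proof.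
move=> eqD [vopt Lmem]; split=> k.
  by move=> kK; rewrite -eqD //; apply: vopt.
by rewrite Lmem; case: (boolP (k \in K)) => //= /eqD->.
Qed.

Lemma pruned_on_level h st :
  pruned_on (fun k => h < dep k) st ->
  pruned_on (fun k => h <= dep k) (prune_level P K zeta st h).
Proof.
move=> inv; rewrite /prune_level.
have lvlE (k : nat * nat) :
    k \in enum_fset (level P K h) -> k \in K /\ dep k = h.
  by rewrite !inE /= => /andP[-> /eqP].
suff: pruned_on (fun k => (h < dep k) || (k \in enum_fset (level P K h)))
        (foldl (prune_node P K zeta h) st (level P K h)).
  apply: eq_pruned_on => k kK /=.
  have -> : (k \in enum_fset (level P K h)) = (dep k == h).
    by rewrite !inE /= kK.
  by rewrite [RHS]leq_eqVlt orbC eq_sym.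
elim/last_ind: (enum_fset _) lvlE => [|s k IHs] sK.
  by apply: eq_pruned_on inv => k _; rewrite in_nil orbF.
have [kK dk] : k \in K /\ dep k = h by apply: sK; rewrite mem_rcons mem_head.
rewrite foldl_rcons -[X in prune_node _ _ _ X]dk.
apply: (@eq_pruned_on (predU1 k (fun k => (h < dep k) || (k \in s)))) => [x xK|].
  by rewrite /= mem_rcons inE orbCA.
apply: pruned_on_node => // [c cK dc|]; first by rewrite dc dk ltnS leqnn.
by rewrite dk; apply: IHs => x xs; apply: sK; rewrite mem_rcons inE xs orbT.
Qed.

(** A node of maximal depth has no successor, so it is an atomic interval: it
    is its only tiling, and it is not removable. *)
Lemma pruned_on_init :
  pruned_on (fun k => max_depth P K <= dep k) (pruning_init P K zeta).
Proof.
have atom (k : nat * nat) : k \in K -> max_depth P K <= dep k -> k.1 = k.2.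
  move=> kK maxk; apply/eqP; rewrite -succ_eq0 //; apply/eqP/fsetP=> c.
  rewrite in_fset0 mem_succ //; apply/negP=> /and3P[cK _ /eqP dc].
  by have := leq_trans (depth_le_max cK) maxk; rewrite dc ltnn.
split=> k.
  move=> kK maxk; rewrite /= !inE /= kK eqn_leq maxk depth_le_max //=.
  exact/optimal_atom/atom.
rewrite /=; case: (boolP (k \in K)) => //= kK.
have [maxk|] := boolP (max_depth P K <= dep k); rewrite //=.
by rewrite (asboolF (removable_atom (atom k kK maxk))).
Qed.

Lemma pruned_on_run : pruned_on predT (pruning_run P K zeta).
Proof.
have run d st : pruned_on (fun k => d < dep k) st ->
    pruned_on predT (foldl (prune_level P K zeta) st (rev (iota 1 d))).
  elim: d st => [|d IHd] st inv; first exact: eq_pruned_on inv.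
  rewrite -[d.+1]addn1 iotaD rev_cat /= add1n; apply: IHd.
  exact: pruned_on_level.
apply/run/(eq_pruned_on _ pruned_on_init) => k kK.
by have := depth_le_max kK; rewrite /depth /=; lia.
Qed.

End Forest.

Theorem proposition3p2 (m N : nat) (P : nat -> {set 'I_m})
    (K : {fset nat * nat}) (zeta : nat * nat -> nat)
    (m_ge1 : 1 <= m)
    (family : reference_family N P K zeta)
    (forest : forest_structure P K)
    (complete : complete_family N K) :
  (pruning_algorithm P K zeta).1 = pruned_index_set K zeta.
Proof.
have [_ Lmem] := pruned_on_run family forest complete.
rewrite /pruning_algorithm; case: pruning_run Lmem => L v /= Lmem.
by apply/fsetP=> k; rewrite Lmem !inE.
Qed.
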